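(* Let $n\ge2$ and let $\Omega\subset\mathbb{R}^n$ be a bounded domain. Let $\Omega_\infty=\Omega\times(0,\infty)$ and $P_\infty=(\overline{\Omega}\times\{0\})\cup(\partial\Omega\times[0,\infty))$. Let $H$ satisfy Conditions A, B and C, with $k\ge1$. Let $h\in C(P_\infty)$ satisfy $0<\inf_{P_\infty}h\le\sup_{P_\infty}h<\infty$, and let $T>0$. (a) Let $u$ be lower semicontinuous on $\Omega_\infty\cup P_\infty$ with $u>0$, and suppose that $H(Du,D^2u)-u^{k-1}u_t\le0$ in $\Omega_\infty$ in the viscosity sense. Assume that $u=h$ on $\partial\Omega\times[T,\infty)$. If $\nu_{\inf}=\lim_{t\to\infty}\big(\inf_{\partial\Omega\times[t,\infty)}h\big)$, then $$\lim_{t\to\infty}\Big(\inf_{\overline{\Omega}\times[t,\infty)}u\Big)=\nu_{\inf}.$$ (b) Let $u$ be upper semicontinuous on $\Omega_\infty\cup P_\infty$ with $u>0$, and suppose that $H(Du,D^2u)-u^{k-1}u_t\ge0$ in $\Omega_\infty$ in the viscosity sense. Assume that $u=h$ on $\partial\Omega\times[T,\infty)$. If $\mu_{\sup}=\lim_{t\to\infty}\big(\sup_{\partial\Omega\times[t,\infty)}h\big)$, then $$\lim_{t\to\infty}\Big(\sup_{\overline{\Omega}\times[t,\infty)}u\Big)=\mu_{\sup}.$$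
   Context: $S^n$ is the set of real symmetric $n\times n$ matrices, $I$ the identity matrix, $O$ the zero matrix, and $X\le Y$ means $Y-X$ is positive semidefinite. Condition A: $H:\mathbb{R}^n\times S^n\to\mathbb{R}$ is continuous, $H(p,O)=0$ for all $p\in\mathbb{R}^n$, and $H(p,X)\le H(p,Y)$ for all $p\in\mathbb{R}^n$ and all $X\le Y$ in $S^n$. Condition B: there is a constant $k_1\ge0$ such that for all $(p,X)\in\mathbb{R}^n\times S^n$: $H(\theta p,X)=|\theta|^{k_1}H(p,X)$ for all $\theta\in\mathbb{R}$, and $H(p,\theta X)=\theta H(p,X)$ for all $\theta>0$. Set $k=k_1+1$. If $k_1=0$ then $H(p,X)=H(X)$ does not depend on $p$. It is not assumed that $H$ is odd in $X$. Condition C: for $\Lambda\in\mathbb{R}$ set $$m(\Lambda)=\min\Big(\min_{|e|=1}H(e,I-\Lambda e\otimes e),\,-\max_{|e|=1}H(e,\Lambda e\otimes e-I)\Big),$$ $$M(\Lambda)=\max\Big(\max_{|e|=1}H(e,I-\Lambda e\otimes e),\,-\min_{|e|=1}H(e,\Lambda e\otimes e-I)\Big).$$ Then $m(\Lambda)>0$ for all $\Lambda<1$, and there is $\Lambda_1\ge1$ such that $M(\Lambda)<0$ for all $\Lambda\ge\Lambda_1$. Viscosity sense: $H(Du,D^2u)-u^{k-1}u_t\ge0$ (respectively $\le0$) in $\Omega_\infty$ means that whenever $\psi$ is $C^2$ in $x$ and $C^1$ in $t$ and $u-\psi$ has a maximum (respectively minimum) at $(y,s)\in\Omega_\infty$,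 then $H(D\psi,D^2\psi)(y,s)-u(y,s)^{k-1}\psi_t(y,s)\ge0$ (respectively $\le0$). *)

(* Defs.v *)
From HB Require Import structures.
From mathcomp Require Import all_boot all_order all_algebra.
From mathcomp Require Import all_classical all_reals all_analysis.
Set Implicit Arguments.
Unset Strict Implicit.
Unset Printing Implicit Defensive.
Import Order.TTheory GRing.Theory Num.Theory.
Import numFieldNormedType.Exports.
Local Open Scope classical_set_scope.
Local Open Scope ring_scope.

(* R^n is 'rV[R]_n. Its library norm is the sup norm, which is used here only
   for topology and boundedness; |e| = 1 refers to the Euclidean norm below. *)

Definition enorm (R : realType) (n : nat) (e : 'rV[R]_n) : R :=
  Num.sqrt (\sum_(i < n) e 0 i ^+ 2).

Definition unit_sphere (R : realType) (n : nat) : set 'rV[R]_n :=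
  [set e | enorm e = 1].

Definition outer (R : realType) (n : nat) (e : 'rV[R]_n) : 'M[R]_n :=
  e^T *m e.

Definition Sym (R : realType) (n : nat) : set 'M[R]_n := [set X | X^T = X].

Definition psd (R : realType) (n : nat) (X : 'M[R]_n) : Prop :=
  X^T = X /\ forall v : 'rV[R]_n, 0 <= (v *m X *m v^T) 0 0.

Definition mx_le (R : realType) (n : nat) (X Y : 'M[R]_n) : Prop :=
  psd (Y - X).

(* H : R^n x S^n -> R is represented by a function on R^n x 'M_n about which
   nothing is assumed outside R^n x S^n. *)

Definition conditionA (R : realType) (n : nat)
    (H : 'rV[R]_n -> 'M[R]_n -> R) : Prop :=
  [/\ {within [set: 'rV[R]_n] `*` Sym (R:=R) (n:=n),
         continuous (fun z : 'rV[R]_n * 'M[R]_n => H z.1 z.2)},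
      forall p, H p 0 = 0 &
      forall p X Y, Sym X -> Sym Y -> mx_le X Y -> H p X <= H p Y].

(* With powR, 0 `^ 0 = 1, so for k1 = 0 and theta = 0 the first scaling law
   reads H(0, X) = H(p, X), in agreement with the last clause. *)
Definition conditionB (R : realType) (n : nat)
    (H : 'rV[R]_n -> 'M[R]_n -> R) (k1 : R) : Prop :=
  [/\ 0 <= k1,
      forall p X theta, Sym X -> H (theta *: p) X = `|theta| `^ k1 * H p X,
      forall p X theta, Sym X -> 0 < theta ->
        H p (theta *: X) = theta * H p X &
      k1 = 0 -> forall p q X, Sym X -> H p X = H q X].

(* The extrema over the unit sphere are written with inf and sup; under
   conditionA and n >= 1 they are attained. *)

Definition mLow (R : realType) (n : nat) (H : 'rV[R]_n -> 'M[R]_n -> R)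
    (L : R) : R :=
  Num.min
    (inf [set H e (1%:M - L *: outer e) | e in unit_sphere (R:=R) (n:=n)])
    (- sup [set H e (L *: outer e - 1%:M) | e in unit_sphere (R:=R) (n:=n)]).

Definition MUp (R : realType) (n : nat) (H : 'rV[R]_n -> 'M[R]_n -> R)
    (L : R) : R :=
  Num.max
    (sup [set H e (1%:M - L *: outer e) | e in unit_sphere (R:=R) (n:=n)])
    (- inf [set H e (L *: outer e - 1%:M) | e in unit_sphere (R:=R) (n:=n)]).

Definition conditionC (R : realType) (n : nat)
    (H : 'rV[R]_n -> 'M[R]_n -> R) : Prop :=
  (forall L, L < 1 -> 0 < mLow H L) /\
  (exists2 L1, 1 <= L1 & forall L, L1 <= L -> MUp H L < 0).

Definition bounded_domain (R : realType) (n : nat) (Omega : set 'rV[R]_n) :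
    Prop :=
  [/\ Omega !=set0, open Omega, connected Omega & bounded_set Omega].

Definition bdry (T : topologicalType) (A : set T) : set T :=
  closure A `\` interior A.

Definition cylinder (R : realType) (n : nat) (Omega : set 'rV[R]_n) :
    set ('rV[R]_n * R) :=
  Omega `*` [set t | 0 < t].

Definition pbdry (R : realType) (n : nat) (Omega : set 'rV[R]_n) :
    set ('rV[R]_n * R) :=
  (closure Omega `*` [set 0]) `|` (bdry Omega `*` [set t | 0 <= t]).

(* Semicontinuity relative to A: in the subspace topology of A the points
   outside A are isolated, so the condition is void there. *)

Definition lsc_on (T : topologicalType) (R : realType) (A : set T)
    (f : T -> R) : Prop :=
  lower_semicontinuous (fun x : subspace A => (f x)%:E).

Definition usc_on (T : topologicalType) (R : realType) (A : set T)
    (f : T -> R) : Prop :=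
  lsc_on A (fun x => - f x).

Definition dx (R : realType) (n : nat) (i : 'I_n) (psi : 'rV[R]_n * R -> R) :
    'rV[R]_n * R -> R :=
  'D_((delta_mx 0 i, 0) : 'rV[R]_n * R) psi.

Definition dt (R : realType) (n : nat) (psi : 'rV[R]_n * R -> R) :
    'rV[R]_n * R -> R :=
  'D_((0, 1) : 'rV[R]_n * R) psi.

Definition gradx (R : realType) (n : nat) (psi : 'rV[R]_n * R -> R)
    (z : 'rV[R]_n * R) : 'rV[R]_n :=
  \row_i dx i psi z.

Definition hessx (R : realType) (n : nat) (psi : 'rV[R]_n * R -> R)
    (z : 'rV[R]_n * R) : 'M[R]_n :=
  \matrix_(i, j) dx i (dx j psi) z.

(* C^2 in x and C^1 in t on an open set D: psi and the derivatives D psi,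
   D^2 psi, psi_t exist and are continuous in (x, t). *)
Definition C21_on (R : realType) (n : nat) (D : set ('rV[R]_n * R))
    (psi : 'rV[R]_n * R -> R) : Prop :=
  forall z, D z ->
    [/\ {for z, continuous psi},
        derivable psi z (0, 1) /\ {for z, continuous (dt psi)},
        forall i, derivable psi z (delta_mx 0 i, 0) /\
                  {for z, continuous (dx i psi)} &
        forall i j, derivable (dx j psi) z (delta_mx 0 i, 0) /\
                    {for z, continuous (dx i (dx j psi))}].

Definition max_at (T : Type) (R : realType) (D : set T) (f : T -> R) (z : T) :
    Prop :=
  D z /\ forall w, D w -> f w <= f z.

Definition min_at (T : Type) (R : realType) (D : set T) (f : T -> R) (z : T) :
    Prop :=
  D z /\ forall w, D w -> f z <= f w.

Definition pde (R : realType) (n : nat) (H : 'rV[R]_n -> 'M[R]_n -> R) (k : R)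
    (u psi : 'rV[R]_n * R -> R) (z : 'rV[R]_n * R) : R :=
  H (gradx psi z) (hessx psi z) - u z `^ (k - 1) * dt psi z.

(* Extrema of u - psi are taken over all of D. This gives the weakest form of
   the viscosity inequalities: those formulated with local extrema and test
   functions that are only locally C^{2,1} imply these. *)

Definition visc_sub (R : realType) (n : nat) (H : 'rV[R]_n -> 'M[R]_n -> R)
    (k : R) (D : set ('rV[R]_n * R)) (u : 'rV[R]_n * R -> R) : Prop :=
  forall psi z, C21_on D psi -> max_at D (fun w => u w - psi w) z ->
    0 <= pde H k u psi z.

Definition visc_super (R : realType) (n : nat) (H : 'rV[R]_n -> 'M[R]_n -> R)
    (k : R) (D : set ('rV[R]_n * R)) (u : 'rV[R]_n * R -> R) : Prop :=
  forall psi z, C21_on D psi -> min_at D (fun w => u w - psi w) z ->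
    pde H k u psi z <= 0.

Definition inf_over (T : Type) (R : realType) (A : set T) (f : T -> R) :
    \bar R :=
  ereal_inf [set (f z)%:E | z in A].

Definition sup_over (T : Type) (R : realType) (A : set T) (f : T -> R) :
    \bar R :=
  ereal_sup [set (f z)%:E | z in A].

Definition from_time (R : realType) (n : nat) (A : set 'rV[R]_n) (t : R) :
    set ('rV[R]_n * R) :=
  A `*` [set s | t <= s].

(* Main.v *)
(* Both parts are comparisons with explicit paraboloids. Choose x0 outside the
   closure of Omega; for psi = a + b|x - x0|^2 + g(t) Condition C with Lambda = 0
   and the scaling laws give H(D psi, D^2 psi) >= eta > 0 when b > 0, and <= - eta
   when the quadratic term has the opposite sign.

   (a) If u >= c on the lateral boundary after time T, take the barrier
   c - b B + b|x - x0|^2 - eps (t - s)^2 with B = max |x - x0|^2 and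
   eps = c / (s - T)^2. It is <= c everywhere, and <= 0 < u before T and after
   2s - T, so if u < psi somewhere then u touches psi from above inside; there
   eta <= u^(k-1) psi_t <= 2 c^(k-1) eps s, which fails for s large. Hence
   u >= c - b B at every large time s, with b arbitrarily small.

   (b) The mirrored argument needs an upper bound for u^(k-1), i.e. for u, at the
   touching point. That bound comes first, from a barrier whose time part is C^1,
   nondecreasing, zero up to a given time, and eventually above u. *)
Require Import Defs.
From HB Require Import structures.
From mathcomp Require Import all_boot all_order all_algebra.
From mathcomp Require Import all_classical all_reals all_analysis.
From mathcomp Require Import ring lra.
Set Implicit Arguments.
Unset Strict Implicit.
Unset Printing Implicit Defensive.
Import Order.TTheory GRing.Theory Num.Theory.
Import numFieldNormedType.Exports.
Local Open Scope classical_set_scope.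
Local Open Scope ring_scope.

(** * Minima of semicontinuous functions on compact sets *)

(** The sublevel sets of [f - g] in [K], at levels attained in [K], generate a proper filter; its
    cluster points in [K] are minimizers. *)
Lemma lsc_sub_argmin (T : topologicalType) (R : realType) (A K : set T)
    (f g : T -> R) :
  lsc_on A f -> continuous g -> compact K -> K `<=` A -> K !=set0 ->
  exists2 p, K p & forall y, K y -> f p - g p <= f y - g y.
Proof.
move=> lscf cg cK KA K0.
pose S y := K `&` [set x | f x - g x <= f y - g y].
pose F := filter_from K S.
have FF : ProperFilter F.
  apply: filter_from_proper; last by move=> y Ky; exists y; split=> //=.
  apply: filter_from_filter => // i j Ki Kj.
  have [le|le] := leP (f i - g i) (f j - g j).
  - exists i => // x [Kx /= xi]; split; split=> //=; exact: le_trans le.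
  - exists j => // x [Kx /= xj]; split; split=> //=; apply: le_trans xj _.
    exact: ltW.
have FK : F K by case: K0 => y Ky; exists y => // x [].
have [p [Kp clp]] := cK F FF FK.
exists p => // y Ky; rewrite leNgt; apply/negP => lt_yp.
(* Half the gap: near [p], within [A], [f] stays above [f p - d] and [g] below [g p + d], so [f - g]
   stays above its value at [y], against clustering. *)
pose d := (f p - g p - (f y - g y)) / 2.
have d0 : 0 < d by rewrite /d; lra.
have /(lscf (p : subspace A) (f p - d)) [V nV HV] :
  ((f p - d)%:E < (f p)%:E)%E by rewrite lte_fin; lra.
have nV' : nbhs p [set x | A x -> V x].
  have Ap := KA _ Kp.
  by move: nV; rewrite /nbhs /= /nbhs_subspace mem_set //.
have ng : nbhs p [set x | g x < g p + d].
  have /cvgrPdist_lt /(_ d d0) := cg p.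
  by apply: filterS => x /=; rewrite ltr_distlC => /andP[].
have [x [[Kx /= xy] [/(_ (KA _ Kx)) Vx /= gx]]] :=
  clp (S y) _ (ex_intro2 _ _ y Ky (fun x Sx => Sx)) (filterI nV' ng).
move: (HV x Vx) xy gx; rewrite lte_fin /d; lra.
Qed.

(** * Derivatives of the barriers *)

(** Dividing the remainder by [s] leaves an error of at most [K |s|]. This one criterion serves
    paraboloids, time parabolas and truncated squares. *)
Lemma is_derive_quadratic (R : realType) (V : normedModType R) (f : V -> R)
    (z v : V) (l K : R) :
  (forall s, `|s| <= 1 -> `|f (s *: v + z) - f z - s * l| <= K * s ^+ 2) ->
  is_derive z v f l.
Proof.
move=> q.
have K0 : 0 <= K.
  by apply: le_trans (le_trans (normr_ge0 _) (q 1 _)) _;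
    rewrite ?normr1 // expr1n mulr1.
have cv : s^-1 *: ((f \o shift z) (s *: v) - f z) @[s --> (0 : R)^'] --> l.
  apply/cvgrPdist_le => e e0.
  have d0 : 0 < Num.min 1 (e / (K + 1)).
    by rewrite lt_min ltr01 divr_gt0 // ltr_pwDr.
  near=> s.
  have s0 : s != 0 by near: s; exact: nbhs_dnbhs_neq.
  have : `|s| <= Num.min 1 (e / (K + 1)).
    by near: s; apply: dnbhs0_le.
  rewrite le_min => /andP[s1 se].
  rewrite distrC -(ler_pM2l (_ : 0 < `|s|)) ?normr_gt0 // -normrM mulrBr /=.
  rewrite /GRing.scale /= mulVKf //; apply: le_trans (q s s1) _.
  rewrite -real_normK ?num_real // expr2 mulrCA ler_wpM2l //.
  rewrite ler_pdivlMr ?ltr_pwDr // in se; apply: le_trans se.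
  by rewrite mulrC ler_wpM2l // lerDl.
split; first by apply/cvg_ex; exists l.
exact/cvg_lim.
Unshelve. all: by end_near.
Qed.

Definition sqdist (R : realType) (n : nat) (x0 x : 'rV[R]_n) : R :=
  \sum_i (x 0 i - x0 0 i) ^+ 2.

Lemma sqdist_shift (R : realType) (n : nat) (x0 x : 'rV[R]_n) (s : R)
    (i : 'I_n) :
  sqdist x0 (s *: delta_mx 0 i + x) =
  sqdist x0 x + 2 * s * (x 0 i - x0 0 i) + s ^+ 2.
Proof.
rewrite /sqdist (bigD1 i) //= [in RHS](bigD1 i) //= !mxE !eqxx /=.
rewrite (eq_bigr (fun j => (x 0 j - x0 0 j) ^+ 2)); first by ring.
by move=> j ji; rewrite !mxE (negbTE ji) andbF mulr0 add0r.
Qed.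

(** Both signs of [b] occur, and [g] is a parabola or the series of [C1_series]. *)
Definition barrier (R : realType) (n : nat) (x0 : 'rV[R]_n) (a b : R)
    (g : R -> R) (z : 'rV[R]_n * R) : R :=
  a + b * sqdist x0 z.1 + g z.2.

Section barrier_derivatives.
Context (R : realType) (n : nat) (x0 : 'rV[R]_n) (a b : R) (g g' : R -> R).
Hypothesis dg : forall t : R, is_derive t (1 : R) g (g' t).
Hypothesis cg' : continuous g'.

Let psi := barrier x0 a b g.

Let coord_continuous_fst (i : 'I_n) :
  continuous (fun z : 'rV[R]_n * R => z.1 0 i).
Proof.
move=> z; apply: (@continuous_comp _ _ _ fst (fun x : 'rV[R]_n => x 0 i)).
  exact: cvg_fst.
exact: coord_continuous.
Qed.

Lemma barrier_continuous : continuous psi.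
Proof.
move=> z; rewrite /psi /barrier /sqdist.
apply: cvgD; first apply: cvgD; first exact: cvg_cst.
- apply: cvgM; first exact: cvg_cst.
  apply: cvg_big => [|i _]; first exact: add_continuous.
  rewrite (_ : (fun z0 : 'rV[R]_n * R => (z0.1 0 i - x0 0 i) ^+ 2) =
    (fun z0 => (z0.1 0 i - x0 0 i) * (z0.1 0 i - x0 0 i))); last first.
    by apply/funext => w; rewrite expr2.
  rewrite expr2.
  by apply: cvgM; apply: cvgB; (exact: coord_continuous_fst || exact: cvg_cst).
- apply: (@continuous_comp _ _ _ snd g); first exact: cvg_snd.
  apply: differentiable_continuous; apply/derivable1_diffP.
  by case: (dg z.2).
Qed.

Lemma is_derive_barrier_dx (i : 'I_n) (z : 'rV[R]_n * R) :
  is_derive z (delta_mx 0 i, 0) psi (2 * b * (z.1 0 i - x0 0 i)).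
Proof.
apply: (@is_derive_quadratic _ _ _ _ _ _ `|b|) => s _.
rewrite -[s ^+ 2]ger0_norm ?sqr_ge0 // -normrM le_eqVlt; apply/predU1l.
rewrite /psi /barrier /= scaler0 add0r sqdist_shift; congr `|_|.
by ring.
Qed.

Lemma dx_barrier (i : 'I_n) :
  dx i psi = fun z => 2 * b * (z.1 0 i - x0 0 i).
Proof.
by apply/funext => z; exact: (@derive_val _ _ _ _ _ _ _
  (is_derive_barrier_dx i z)).
Qed.

Lemma is_derive_barrier_dxdx (i j : 'I_n) (z : 'rV[R]_n * R) :
  is_derive z (delta_mx 0 i, 0) (dx j psi) (2 * b * (i == j)%:R).
Proof.
rewrite dx_barrier; apply: (@is_derive_quadratic _ _ _ _ _ _ 0) => s _.
rewrite mul0r normr_le0 /= !mxE /= [j == i]eq_sym; apply/eqP.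
by ring.
Qed.

Lemma dxdx_barrier (i j : 'I_n) :
  dx i (dx j psi) = cst (2 * b * (i == j)%:R).
Proof.
by apply/funext => z; exact: (@derive_val _ _ _ _ _ _ _
  (is_derive_barrier_dxdx i j z)).
Qed.

Lemma is_derive_barrier_dt (z : 'rV[R]_n * R) :
  is_derive z (0, 1) psi (g' z.2).
Proof.
(* The spatial part cancels in the time difference quotient, so the derivative of [g] transfers
   unchanged. *)
have E : (fun s : R => s^-1 *: ((psi \o shift z) (s *: (0, 1)) - psi z)) =
         (fun s : R => s^-1 *: ((g \o shift z.2) (s *: 1) - g z.2)).
  apply/funext => s; rewrite /psi /barrier /= scaler0 add0r.
  by congr (_ *: _); ring.
have [d1 d2] := dg z.2.
by split; rewrite /derivable /derive E.
Qed.

Lemma dt_barrier : dt psi = fun z => g' z.2.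
Proof.
by apply/funext => z; exact: (@derive_val _ _ _ _ _ _ _
  (is_derive_barrier_dt z)).
Qed.

Lemma barrier_C21 (D : set ('rV[R]_n * R)) : C21_on D psi.
Proof.
move=> z _; split.
- exact: barrier_continuous.
- split; first by case: (is_derive_barrier_dt z).
  rewrite dt_barrier; apply: (@continuous_comp _ _ _ snd g').
    exact: cvg_snd.
  exact: cg'.
- move=> i; split; first by case: (is_derive_barrier_dx i z).
  rewrite dx_barrier; apply: cvgM; first exact: cvg_cst.
  apply: cvgB; last exact: cvg_cst.
  exact: coord_continuous_fst.
- move=> i j; split; first by case: (is_derive_barrier_dxdx i j z).
  by rewrite dxdx_barrier; exact: cvg_cst.
Qed.

Lemma gradx_barrier (z : 'rV[R]_n * R) : gradx psi z = (2 * b) *: (z.1 - x0).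
Proof. by apply/rowP => i; rewrite !mxE dx_barrier. Qed.

Lemma hessx_barrier (z : 'rV[R]_n * R) : hessx psi z = (2 * b)%:M.
Proof. by apply/matrixP => i j; rewrite !mxE dxdx_barrier mulr_natr. Qed.

End barrier_derivatives.

(** * A C^1 function above a given sequence *)

Section C1_majorant.
Context (R : realType) (a : nat -> R).
Hypothesis a_ge0 : forall i, 0 <= a i.

(** An infinite sum in disguise: the terms [q] and [q'] below vanish up to time [i], so cutting at
    [|t|] loses nothing. *)
Let locally_finite (F : nat -> R -> R) (t : R) : R :=
  \sum_(i < (Num.truncn `|t|).+1) F i t.

Let locally_finiteE (F : nat -> R -> R) (t : R) (M : nat) :
  (forall i s, s <= i%:R -> F i s = 0) -> `|t| < M%:R ->
  locally_finite F t = \sum_(i < M) F i t.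
Proof.
move=> F0 tM; rewrite /locally_finite (big_ord_widen M (F^~ t)); last first.
  by rewrite truncn_lt_nat.
rewrite big_mkcond; apply: eq_bigr => i _; case: ifPn => //.
rewrite -leqNgt => ti; rewrite F0 //; apply: le_trans (ler_norm t) _.
by apply: (le_trans (ltW (truncnS_gt _))); rewrite ler_nat.
Qed.

(** The square flattens the kink at [i], so each term is C^1; it is at least [a i] from [i + 1]
    on. *)
Let q (i : nat) (t : R) : R := a i * Num.max 0 (t - i%:R) ^+ 2.
Let q' (i : nat) (t : R) : R := a i * (2 * Num.max 0 (t - i%:R)).

Let q0 i s : s <= i%:R -> q i s = 0.
Proof. by rewrite -subr_le0 /q => /max_idPl ->; rewrite expr0n mulr0. Qed.

Let q'0 i s : s <= i%:R -> q' i s = 0.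
Proof. by rewrite -subr_le0 /q' => /max_idPl ->; rewrite !mulr0. Qed.

(** A common cutoff for [t] and all points within 1 of it reduces local questions to a fixed finite
    sum. *)
Let bound (s t : R) : `|s| <= 1 ->
  `|s + t| < (Num.truncn (`|t| + 1)).+1%:R /\
  `|t| < (Num.truncn (`|t| + 1)).+1%:R.
Proof.
move=> s1; have := truncnS_gt (`|t| + 1); have := ler_normD s t.
by split; lra.
Qed.

(** Supplies the time part of the barrier that bounds subsolutions: it can be kept at zero up to a
    chosen integer time and then outgrow a prescribed sequence. *)
Lemma C1_series : exists g g' : R -> R,
  [/\ forall t : R, is_derive t (1 : R) g (g' t), continuous g',
      forall t, 0 <= g t /\ 0 <= g' t,
      forall n t, t <= n%:R -> (forall i, (i < n)%N -> a i = 0) -> g t = 0 &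
      forall t i, i%:R + 1 <= t -> a i <= g t].
Proof.
exists (locally_finite q), (locally_finite q'); split.
- move=> t; set M := (Num.truncn (`|t| + 1)).+1.
  apply: (@is_derive_quadratic _ _ _ _ _ _ (\sum_(i < M) a i)) => s s1.
  have [b1 b2] := bound t s1.
  rewrite [s *: _]mulr1 !(locally_finiteE _ b1) // !(locally_finiteE _ b2) //.
  rewrite mulr_sumr -!sumrB mulr_suml; apply: le_trans (ler_norm_sum _ _ _) _.
  apply: ler_sum => i _; rewrite /q /q' [s * _]mulrCA -!mulrBr normrM.
  rewrite ger0_norm //.
  rewrite ler_wpM2l // ler_norml.
  by case: (leP 0 (s + t - i%:R)); case: (leP 0 (t - i%:R)) => h1 h2; nra.
- move=> t; set M := (Num.truncn (`|t| + 1)).+1.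
  apply/cvgrPdist_le => e e0.
  pose K := \sum_(i < M) a i * 2.
  have K0 : 0 <= K by apply: sumr_ge0 => i _; rewrite mulr_ge0.
  have d0 : 0 < Num.min 1 (e / (K + 1)).
    by rewrite lt_min ltr01 divr_gt0 // ltr_pwDr.
  near=> s.
  have : `|s - t| <= Num.min 1 (e / (K + 1)).
    near: s.
    exact: (@pseudometric_normed_Zmodule.cvgr_distC_le _ _ _ _ _ id t).
  rewrite le_min => /andP[s1 se].
  have [] := bound t s1; rewrite subrK => b1 b2.
  rewrite (locally_finiteE _ b1) // (locally_finiteE _ b2) //.
  apply: (@le_trans _ _ (K * `|s - t|)); last first.
    rewrite ler_pdivlMr ?ltr_pwDr // in se; apply: le_trans se.
    by rewrite mulrC ler_wpM2l // lerDl.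
  rewrite -sumrB mulr_suml; apply: le_trans (ler_norm_sum _ _ _) _.
  apply: ler_sum => i _; rewrite /q' -mulrBr -[2 * _ - _]mulrBr.
  rewrite !normrM (ger0_norm (a_ge0 i)) (@ger0_norm _ 2) // -mulrA.
  rewrite ler_wpM2l // ler_wpM2l //.
  have := ler_norm (s - t); have := ler_norm (t - s).
  rewrite distrC [in X in _ -> _ -> X]ler_norml.
  by case: (leP 0 (s - i%:R)); case: (leP 0 (t - i%:R)) => h1 h2; lra.
- move=> t; split; apply: sumr_ge0 => i _.
    by rewrite mulr_ge0 // sqr_ge0.
  by rewrite !mulr_ge0 // le_max lexx.
- move=> n t tn an; apply: big1 => i _.
  have [ni|/an ai] := leqP n i; last by rewrite /q ai mul0r.
  by apply: q0; apply: le_trans tn _; rewrite ler_nat.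
- move=> t i it.
  have i0 : 0 <= i%:R :> R by [].
  have iM : (i < (Num.truncn `|t|).+1)%N.
    by rewrite -(ltr_nat R); have := truncnS_gt `|t|; have := ler_norm t; lra.
  rewrite /locally_finite (bigD1 (Ordinal iM)) //= ler_wpDr //.
    by apply: sumr_ge0 => j _; rewrite mulr_ge0 // sqr_ge0.
  rewrite /q ler_peMr // expr_ge1 //; last by rewrite le_max lexx.
  by rewrite le_max; apply/orP; right; lra.
Unshelve. all: by end_near.
Qed.

End C1_majorant.

(** * Condition C evaluated on paraboloids *)

Lemma enormZ (R : realType) (n : nat) (s : R) (p : 'rV[R]_n) :
  enorm (s *: p) = `|s| * enorm p.
Proof.
rewrite /enorm -sqrtr_sqr -sqrtrM ?sqr_ge0 // mulr_sumr.
by congr Num.sqrt; apply: eq_bigr => i _; rewrite mxE exprMn.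
Qed.

Lemma enorm_sqdist (R : realType) (n : nat) (x0 x : 'rV[R]_n) :
  enorm (x - x0) = Num.sqrt (sqdist x0 x).
Proof. by congr Num.sqrt; apply: eq_bigr => i _; rewrite !mxE. Qed.

(** [inf] defaults to 0 on sets without an infimum, so a positive value certifies a genuine lower
    bound. A negative [sup] is treated likewise below. *)
Lemma inf_gt0_le (R : realType) (E : set R) (x : R) :
  0 < inf E -> E x -> inf E <= x.
Proof.
move=> E0 Ex; apply: ge_inf => //.
have : has_inf E.
  by apply/not_notP => /inf_out E00; rewrite E00 ltxx in E0.
by case.
Qed.

Lemma sup_lt0_ge (R : realType) (E : set R) (x : R) :
  sup E < 0 -> E x -> x <= sup E.
Proof.
move=> E0 Ex; apply: ub_le_sup => //.
have : has_sup E.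
  by apply/not_notP => /sup_out E00; rewrite E00 ltxx in E0.
by case.
Qed.

(** With [e = p / |p|], the two halves of [mLow H 0] bound [H e 1%:M] and [H e (- 1%:M)] separately,
    as [H] need not be odd. Scaling gives a factor [b] from the matrix and [(b |p|)^k1], at least
    [b^k1], from the vector. *)
Lemma paraboloid_bounds (R : realType) (n : nat)
    (H : 'rV[R]_n -> 'M[R]_n -> R) (k1 : R) :
  conditionB H k1 -> 0 < mLow H 0 ->
  forall (b : R) (p : 'rV[R]_n), 0 < b -> 1 <= enorm p ->
    mLow H 0 * b * b `^ k1 <= H (b *: p) b%:M /\
    H (- b *: p) (- b)%:M <= - (mLow H 0 * b * b `^ k1).
Proof.
move=> [k10 Hp HX _] m0 b p b0 p1.
have r0 : 0 < enorm p by apply: lt_le_trans p1.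
pose e := (enorm p)^-1 *: p.
have ue : unit_sphere e.
  by rewrite /unit_sphere /= enormZ gtr0_norm ?invr_gt0 // mulVf // gt_eqF.
have pe : p = enorm p *: e by rewrite scalerA mulfV ?scale1r // gt_eqF.
clearbody e.
have S1 : Sym (1%:M : 'M[R]_n) by rewrite /Sym /= tr_scalar_mx.
have SN1 : Sym (- 1%:M : 'M[R]_n) by rewrite /Sym /= linearN /= tr_scalar_mx.
have le_pow : b `^ k1 <= (b * enorm p) `^ k1.
  by apply: ge0_ler_powR; rewrite ?nnegrE ?ler_peMr // ?mulr_ge0 // ltW.
have m0' := m0; rewrite /mLow lt_min in m0'; case/andP: m0' => inf0 sup0.
have m_le : mLow H 0 <= H e 1%:M.
  rewrite /mLow ge_min; apply/orP; left; apply: inf_gt0_le => //.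
  by exists e => //; rewrite scale0r subr0.
have m_ge : H e (- 1%:M) <= - mLow H 0.
  rewrite lerNr /mLow ge_min; apply/orP; right; rewrite lerN2.
  apply: sup_lt0_ge; first by rewrite -oppr_gt0.
  by exists e => //; rewrite scale0r sub0r.
have ab : `|b * enorm p| = b * enorm p by rewrite ger0_norm // mulr_ge0 // ltW.
have -> : - b *: p = (- (b * enorm p)) *: e by rewrite [in LHS]pe scalerA mulNr.
have -> : b *: p = (b * enorm p) *: e by rewrite [in LHS]pe scalerA.
have -> : (- b)%:M = b *: - 1%:M :> 'M[R]_n.
  by rewrite scalerN scale_scalar_mx mulr1 raddfN.
have -> : b%:M = b *: 1%:M :> 'M[R]_n by rewrite scale_scalar_mx mulr1.
have Sb (X : 'M[R]_n) : Sym X -> Sym (b *: X).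
  by move=> SX; rewrite /Sym /= linearZ /= SX.
rewrite !Hp ?normrN ?ab; do ?exact: Sb.
rewrite !HX //.
have key y : mLow H 0 <= y ->
    mLow H 0 * b * b `^ k1 <= (b * enorm p) `^ k1 * (b * y).
  move=> my; rewrite [mLow H 0 * b]mulrC -mulrA [leRHS]mulrCA.
  rewrite ler_wpM2l ?(ltW b0) //.
  by rewrite mulrC; apply: ler_pM => //; rewrite ?powR_ge0 // ltW.
split; first exact: key.
by rewrite lerNr -!mulrN; apply: key; rewrite lerNr.
Qed.

(** * Compact closures and a center away from the domain *)

Lemma closure_subset_closed (T : topologicalType) (A B : set T) :
  closed B -> A `<=` B -> closure A `<=` B.
Proof.
by move=> cB AB; rewrite [B in _ `<=` B](closure_id _).1 //; exact: closureS.
Qed.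

Lemma bounded_closure_compact (R : realType) (n : nat) (A : set 'rV[R]_n) :
  bounded_set A -> compact (closure A).
Proof.
move=> bA; apply: bounded_closed_compact; last exact: closed_closure.
move: bA; rewrite /= /bounded_near; apply: filterS => M AM.
apply: closure_subset_closed.
- rewrite [X in closed X](_ : _ =
    (fun x : 'rV[R]_n => `|x|) @^-1` [set y | y <= M]) //.
  by apply: closed_comp => [x _|]; [exact: norm_continuous|exact: closed_le].
- by move=> x /AM.
Qed.

Lemma normr_coord_le (R : realType) (m n : nat) (x : 'M[R]_(m, n))
    (i : 'I_m) (j : 'I_n) :
  `|x i j| <= `|x|.
Proof.
rewrite [leRHS]/Num.norm /= mx_normrE.
exact: (@le_bigmax _ _ _ 0 (fun ij => `|x ij.1 ij.2|) (i, j)).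
Qed.

(** The lower bound 1 keeps the gradient of a paraboloid centered at [x0] away from zero, as
    [paraboloid_bounds] requires. *)
Lemma exterior_center (R : realType) (n : nat) (A : set 'rV[R]_n) :
  (0 < n)%N -> bounded_set A ->
  exists (x0 : 'rV[R]_n) (B : R),
    forall x, closure A x -> 1 <= sqdist x0 x <= B.
Proof.
move=> n0 /bounded_closure_compact /compact_bounded.
move=> [M [_ /(_ (`|M| + 1))]]; rewrite (le_lt_trans (ler_norm M)) ?ltrDl //.
move=> /(_ isT) /=; set r := `|M| + 1 => bA.
(* The diagonal shift puts every coordinate of [x - x0] in [[1, 2 r + 1]]: one coordinate gives the
   lower bound, all of them the upper. *)
exists (const_mx (- (r + 1))), (\sum_(i < n) (2 * r + 1) ^+ 2) => x /bA xr.
have xi i : 1 <= x 0 i + (r + 1) <= 2 * r + 1.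
  have : `|x 0 i| <= r by apply: le_trans xr; exact: normr_coord_le.
  by rewrite ler_norml; lra.
apply/andP; split.
- rewrite /sqdist (bigD1 (Ordinal n0)) //= ler_wpDr //.
    by apply: sumr_ge0 => i _; exact: sqr_ge0.
  by rewrite mxE opprK; have := xi (Ordinal n0); nra.
- by apply: ler_sum => i _; rewrite mxE opprK; have := xi i; nra.
Qed.

(** * Limits of infima over late times *)

Lemma lte_between (R : realType) (x y : \bar R) :
  (x < y)%E -> exists r : R, (x < r%:E)%E /\ (r%:E < y)%E.
Proof.
case: x y => [x| |] [y| |] //.
- by rewrite lte_fin => xy; exists ((x + y) / 2); rewrite !lte_fin; lra.
- by move=> _; exists (x + 1); rewrite lte_fin ltrDl ltr01 ltry.
- by move=> _; exists (y - 1); rewrite lte_fin gtrBl ltr01 ltNyr.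
- by move=> _; exists 0; rewrite ltNyr ltry.
Qed.

Lemma sup_overN (T : Type) (R : realType) (A : set T) (f : T -> R) :
  sup_over A f = (- inf_over A (fun z => - f z)%R)%E.
Proof.
rewrite /sup_over /inf_over ereal_supEN image_comp; congr (- ereal_inf _)%E.
Qed.

Lemma inf_over_homo (R : realType) (n : nat) (A : set 'rV[R]_n)
    (f : 'rV[R]_n * R -> R) (s t : R) : s <= t ->
  (inf_over (from_time A s) f <= inf_over (from_time A t) f)%E.
Proof.
move=> st; apply: le_ereal_inf_tmp => _ [z [Az tz] <-].
by apply: ereal_inf_lbound; exists z => //; split => //=; exact: le_trans tz.
Qed.

(** Both infima are nondecreasing in [t], so their limits are suprema. Carrying lower bounds from
    [A] to [B] with loss [e] gives one inequality; the other is inclusion, since [u = h] on [A]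
    after [T]. *)
Lemma inf_over_cvg (R : realType) (n : nat) (A B : set 'rV[R]_n)
    (u h : 'rV[R]_n * R -> R) (T : R) (nu : \bar R) :
  A `<=` B ->
  (forall z, from_time A T z -> u z = h z) ->
  (forall c T1, T <= T1 -> (forall z, from_time A T1 z -> c <= u z) ->
     forall e, 0 < e ->
     exists t0, forall z, from_time B t0 z -> c - e <= u z) ->
  inf_over (from_time A t) h @[t --> +oo] --> nu ->
  inf_over (from_time B t) u @[t --> +oo] --> nu.
Proof.
move=> AB uh low hnu.
have hsup := nondecreasing_cvge (@inf_over_homo _ _ A h).
have usup := nondecreasing_cvge (@inf_over_homo _ _ B u).
suff -> : nu = ereal_sup (range (fun t => inf_over (from_time B t) u)) by [].
rewrite (cvg_unique _ hnu hsup) //; apply/eqP; rewrite eq_le; apply/andP; split.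
- apply: ge_ereal_sup => _ [t _ <-].
  (* Two reals separate the values: [c2] bounds [u] below on [A], and the loss [c2 - c1] still
     leaves [c1] above the supremum belonging to [B]. *)
  rewrite leNgt; apply/negP => /lte_between[c2 [Lc2 c2h]].
  have [c1 [Lc1 c12]] := lte_between Lc2.
  rewrite lte_fin in c12.
  have [|z zA||t0 Ht0] := low c2 (Num.max t T) _ _ (c2 - c1).
  + by rewrite le_max lexx orbT.
  + have zt : from_time A t z.
      by case: zA => ? /= ?; split => //=; apply: le_trans; last eassumption;
        rewrite le_max lexx.
    rewrite -lee_fin uh; last first.
      by case: zA => ? /= ?; split => //=; apply: le_trans; last eassumption;
        rewrite le_max lexx orbT.
    apply: (le_trans (ltW c2h)); apply: ereal_inf_lbound.
    by exists z.
  + by rewrite subr_gt0.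
  + suff : (c1%:E <= ereal_sup (range (fun t => inf_over (from_time B t) u)))%E.
      by rewrite leNgt Lc1.
    apply: le_ereal_sup_tmp; exists (inf_over (from_time B t0) u).
      by exists t0.
    apply: le_ereal_inf_tmp => _ [z /Ht0 + <-].
    by rewrite lee_fin subKr.
- apply: ge_ereal_sup => _ [t _ <-].
  apply: (le_trans (@inf_over_homo _ _ _ _ t (Num.max t T) _)).
    by rewrite le_max lexx.
  apply: le_ereal_sup_tmp; exists (inf_over (from_time A (Num.max t T)) h).
    by exists (Num.max t T).
  apply: le_ereal_inf_tmp => _ [z [Az tz] <-].
  apply: ereal_inf_lbound; exists z; first by split => //; exact: AB.
  congr EFin; apply: uh; split => //=; apply: le_trans tz.
  by rewrite le_max lexx orbT.
Qed.

(** * Touching points and comparison in the cylinder *)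

Section comparison.
Context (R : realType) (n : nat) (Omega : set 'rV[R]_n).
Hypotheses (n_gt0 : (0 < n)%N) (domO : bounded_domain Omega).

Local Notation clO := (cylinder Omega `|` pbdry Omega).

Lemma closed_cylinderP (z : 'rV[R]_n * R) :
  closure Omega z.1 -> 0 <= z.2 -> clO z.
Proof.
case: z => x t /= cx; rewrite le_eqVlt => /predU1P[<-|t0].
  by right; left; split.
have [Ox|nOx] := pselect (Omega x); first by left; split.
right; right; split; last exact: ltW.
by split => //= /interior_subset.
Qed.

Lemma compact_slab (t1 t2 : R) :
  compact (closure Omega `*` [set t | t1 <= t <= t2]).
Proof.
apply: compact_setX.
  by case: domO => _ _ _; exact: bounded_closure_compact.
by rewrite -set_itvcc; exact: segment_compact.
Qed.

(* The touching point is interior because the barrier lies below [f] on the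
   lateral boundary and at all other times. *)
Lemma touching_point (f psi : 'rV[R]_n * R -> R) (t1 t2 : R) :
  lsc_on clO f -> continuous psi -> 0 < t1 ->
  (forall x t, bdry Omega x -> t1 <= t <= t2 -> psi (x, t) <= f (x, t)) ->
  (forall x t, Omega x -> 0 < t -> ~~ (t1 <= t <= t2) ->
     psi (x, t) <= f (x, t)) ->
  forall x t, closure Omega x -> t1 <= t <= t2 -> f (x, t) < psi (x, t) ->
  exists z, [/\ Omega z.1, t1 <= z.2, f z < psi z &
    min_at (cylinder Omega) (fun w => f w - psi w) z].
Proof.
move=> lscf cpsi t1_gt0 lat out x t Ox tt ftx.
have KA : closure Omega `*` [set t | t1 <= t <= t2] `<=` clO.
  move=> z [Oz /andP[tz _]]; apply: closed_cylinderP => //.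
  exact: le_trans (ltW t1_gt0) tz.
have [|[y s] [/= Oy st] ymin] :=
    lsc_sub_argmin lscf cpsi (@compact_slab t1 t2) KA.
  by exists (x, t).
have neg : f (y, s) - psi (y, s) < 0.
  by apply: le_lt_trans (ymin (x, t) _) _ => //; rewrite subr_lt0.
have Oy' : Omega y.
  have [//|nOy] := pselect (Omega y).
  have : psi (y, s) <= f (y, s).
    by apply: lat => //; split => // /interior_subset.
  by rewrite -subr_ge0 leNgt neg.
have [s1 s2] := andP st.
exists (y, s); split => //=; first by rewrite -subr_lt0.
split => /=; first by split => //=; exact: lt_le_trans s1.
move=> [x' t'] [/= Ox' t'0].
have [tt'|tt'] := boolP (t1 <= t' <= t2).
  by apply: ymin; split => //=; exact: subset_closure.
by apply: (le_trans (ltW neg)); rewrite subr_ge0; exact: out.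
Qed.

Context (H : 'rV[R]_n -> 'M[R]_n -> R) (k1 k : R).
Hypotheses (HB : conditionB H k1) (HC : conditionC H).
Hypothesis k_ge1 : 1 <= k.

Let powM (v M : R) : 0 < v -> v <= M -> v `^ (k - 1) <= M `^ (k - 1).
Proof.
move=> v0 vM; apply: ge0_ler_powR; rewrite ?nnegrE ?subr_ge0 ?(ltW v0) //.
exact: le_trans (ltW v0) vM.
Qed.

(** Selects the times [s] at which a parabola of fixed height, spread over a window of half-width
    [s - T], is too flat to balance [H]. *)
Lemma quadratic_dominates (C e T : R) : 0 <= C -> 0 < e -> 0 < T ->
  exists2 t0, T < t0 & forall s, t0 <= s -> C * s < e * (s - T) ^+ 2.
Proof.
(* From [s >= 2 T] follows [(s - T)^2 >= s^2 / 4], and from [s > 4 C / e] follows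
   [s^2 / 4 > (C / e) s]. *)
move=> C0 e0 T0; exists (2 * T + 4 * (C / e) + 1).
  have : 0 <= C / e by rewrite divr_ge0 // ltW.
  by lra.
move=> s; have -> : C = e * (C / e) by rewrite mulrCA mulfV ?mulr1 // gt_eqF.
have : 0 <= C / e by rewrite divr_ge0 // ltW.
rewrite [e * (C / e) / e]mulrAC mulfV ?gt_eqF // mul1r.
move: (C / e) => c c0 cs; rewrite -mulrA ltr_pM2l //.
nra.
Qed.

Let is_derive_square (c s t : R) :
  is_derive t (1 : R) (fun t => c * (t - s) ^+ 2) (2 * c * (t - s)).
Proof.
apply: (@is_derive_quadratic _ _ _ _ _ _ `|c|) => r _.
rewrite -[r ^+ 2]ger0_norm ?sqr_ge0 // -normrM le_eqVlt; apply/predU1l.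
by congr `|_|; rewrite [r *: _]mulr1; ring.
Qed.

Let continuous_affine (c s : R) : continuous (fun t => 2 * c * (t - s)).
Proof.
by move=> t; apply: cvgM; [exact: cvg_cst|apply: cvgB; [|exact: cvg_cst]].
Qed.

Lemma supersolution_lower_bound (u : 'rV[R]_n * R -> R) (c T e : R) :
  lsc_on clO u -> (forall z, clO z -> 0 < u z) ->
  visc_super H k (cylinder Omega) u ->
  0 < T -> (forall z, from_time (bdry Omega) T z -> c <= u z) -> 0 < e ->
  exists t0, forall z, from_time (closure Omega) t0 z -> c - e <= u z.
Proof.
move=> lscu u0 super T0 uc e0.
(* Only a positive [c] gives a barrier; otherwise [c - e < 0 < u]. *)
have [c0|c0] := leP c 0.
  exists 0 => -[x t] [/= Ox t0].
  have := u0 (x, t) (@closed_cylinderP (x, t) Ox t0).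
  by move: (u _) => v; lra.
have [_ _ _ bO] := domO.
have [x0 [B HB0]] := exterior_center n_gt0 bO.
have m0 : 0 < mLow H 0 by apply: HC.1; exact: ltr01.
(* Makes the spatial loss [b * B] at most [e]; the added 1 keeps the denominator positive. *)
pose b := e / (`|B| + 1).
have b0 : 0 < b by rewrite divr_gt0 // ltr_wpDl.
have bB : b * B <= e.
  rewrite /b mulrAC ler_pdivrMr ?ltr_wpDl // ler_pM2l //.
  by apply: (le_trans (ler_norm B)); rewrite lerDl.
have bb0 : 0 < 2 * b by rewrite mulr_gt0.
pose eta := mLow H 0 * (2 * b) * (2 * b) `^ k1.
have eta0 : 0 < eta by rewrite !mulr_gt0 // powR_gt0.
(* With [eps = c / (s - T)^2], this is the bound [c^(k-1) * 2 eps s] for [u^(k-1) psi_t], multiplied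
   by [(s - T)^2 / s]. *)
pose C := c `^ (k - 1) * (2 * c).
have C0 : 0 <= C by rewrite !mulr_ge0 ?powR_ge0 // ltW.
have [t0 Tt0 dom] := quadratic_dominates C0 eta0 T0.
exists t0 => -[x s] [/= Ox st0]; rewrite leNgt; apply/negP => us.
have Ts : T < s by exact: lt_le_trans st0.
have s0 : 0 < s by exact: lt_trans Ts.
have d0 : 0 < (s - T) ^+ 2 by rewrite exprn_gt0 // subr_gt0.
pose eps := c / (s - T) ^+ 2.
have eps0 : 0 < eps by rewrite divr_gt0.
have epsE : eps * (s - T) ^+ 2 = c by rewrite /eps mulfVK // gt_eqF.
clearbody eps.
pose g t := (- eps) * (t - s) ^+ 2.
have dg := @is_derive_square (- eps) s.
have cg := @continuous_affine (- eps) s.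
pose psi := barrier x0 (c - b * B) b g.
have psi_le y t : closure Omega y -> psi (y, t) <= c - eps * (t - s) ^+ 2.
  move=> /HB0 /andP[_ yB]; rewrite /psi /barrier /g /=.
  have : b * sqdist x0 y <= b * B by rewrite ler_pM2l.
  by lra.
have psi_c y t : closure Omega y -> psi (y, t) <= c.
  move=> /psi_le /le_trans; apply; rewrite lerBlDr lerDl.
  by rewrite mulr_ge0 ?sqr_ge0 // ltW.
(* The window is symmetric about [s]; at its ends the time parabola has dropped by exactly [c], so
   outside it [psi <= 0 < u]. *)
have [||||z [Oz z1 uz zmin]] := @touching_point u psi T (2 * s - T) lscu
    (barrier_continuous dg) T0 _ _ x s Ox.
- move=> y t Oy /andP[Tt _]; apply: (@le_trans _ _ c).
    by apply: psi_c; case: Oy.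
  by apply: uc; split.
- move=> y t Oy t_gt0 tout; apply: (@le_trans _ _ 0).
    apply: (le_trans (psi_le _ _ (subset_closure Oy))).
    rewrite subr_le0 -{1}epsE ler_pM2l //.
    move: tout; rewrite negb_and -!ltNge => /orP[] ?; nra.
  apply/ltW/u0; apply: closed_cylinderP; last exact: ltW.
  exact: subset_closure.
- by apply/andP; split; lra.
- apply: (lt_le_trans us); rewrite /psi /barrier /g /= subrr expr0n mulr0 addr0.
  have /HB0/andP[y1 _] := Ox.
  have : 0 <= b * sqdist x0 x by rewrite mulr_ge0 ?(ltW b0) // (le_trans _ y1).
  by lra.
have := super psi z (@barrier_C21 _ _ x0 _ b _ _ dg cg _) zmin.
rewrite /pde gradx_barrier hessx_barrier.
rewrite (dt_barrier x0 _ _ dg).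
have cz := subset_closure Oz.
have /HB0/andP[z1' _] := cz.
have [|Hge _] := paraboloid_bounds HB m0 bb0 (p := z.1 - x0).
  by rewrite enorm_sqdist -sqrtr1 ler_wsqrtr.
have z20 : 0 < z.2 by exact: lt_le_trans z1.
have uz0 : 0 < u z by apply: u0; apply: closed_cylinderP => //; exact: ltW.
have uzc : u z `^ (k - 1) <= c `^ (k - 1).
  apply: powM => //; apply: (le_trans (ltW uz)).
  by case: (z) cz => y t; exact: psi_c.
have := dom s st0; rewrite -/eta in Hge.
have -> : C * s = c `^ (k - 1) * (2 * eps * s) * (s - T) ^+ 2.
  by rewrite /C -{2}epsE; ring.
rewrite ltr_pM2r // => dom' Hle.
suff : u z `^ (k - 1) * (2 * - eps * (z.2 - s)) <=
  c `^ (k - 1) * (2 * eps * s) by lra.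
apply: (@le_trans _ _ (u z `^ (k - 1) * (2 * eps * s))).
  by rewrite ler_wpM2l ?powR_ge0 //; nra.
by apply: ler_wpM2r => //; rewrite !mulr_ge0 ?(ltW eps0) ?(ltW s0).
Qed.

(** This is [touching_point] for [- u] and [- psi], where a minimum becomes a maximum. The
    conclusion forces [g] to decrease at a definite rate, which each application contradicts with
    its own [g]. *)
Lemma subsolution_touching (u : 'rV[R]_n * R -> R) (x0 : 'rV[R]_n)
    (a b : R) (g g' : R -> R) (t1 t2 : R) :
  usc_on clO u -> visc_sub H k (cylinder Omega) u ->
  (forall t : R, is_derive t (1 : R) g (g' t)) -> continuous g' ->
  let psi := barrier x0 a (- b) g in
  0 < t1 -> 0 < b -> (forall x, closure Omega x -> 1 <= sqdist x0 x) ->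
  (forall x t, bdry Omega x -> t1 <= t <= t2 -> u (x, t) <= psi (x, t)) ->
  (forall x t, Omega x -> 0 < t -> ~~ (t1 <= t <= t2) ->
     u (x, t) <= psi (x, t)) ->
  forall x t, closure Omega x -> t1 <= t <= t2 -> psi (x, t) < u (x, t) ->
  exists z, [/\ closure Omega z.1, t1 <= z.2 &
    u z `^ (k - 1) * g' z.2 <= - (mLow H 0 * (2 * b) * (2 * b) `^ k1)].
Proof.
move=> uscu sub dg cg psi t1_gt0 b0 x0_far lat out x t Ox tt psi_u.
have cpsi : continuous (fun w => - psi w).
  by move=> w; apply: cvgN; exact: (barrier_continuous dg).
have [|||z [Oz z1 _ [_ zmin]]] := @touching_point (fun w => - u w) _ t1 t2 uscu
    cpsi t1_gt0 _ _ x t Ox tt.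
- by move=> y s Oy st; rewrite lerN2; exact: lat.
- by move=> y s Oy s0 st; rewrite lerN2; exact: out.
- by rewrite ltrN2.
have zmax : max_at (cylinder Omega) (fun w => u w - psi w) z.
  split; first by split => //=; exact: lt_le_trans z1.
  by move=> w /zmin; rewrite !opprK; lra.
have := sub psi z (@barrier_C21 _ _ x0 _ (- b) _ _ dg cg _) zmax.
rewrite /pde gradx_barrier hessx_barrier (dt_barrier x0 _ _ dg) mulrN.
have cz := subset_closure Oz.
have b20 : 0 < 2 * b by rewrite mulr_gt0.
have m0 : 0 < mLow H 0 by apply: HC.1; exact: ltr01.
have [|_ Hle Hge] := paraboloid_bounds HB m0 b20 (p := z.1 - x0).
  by rewrite enorm_sqdist -sqrtr1 ler_wsqrtr // x0_far.
by exists z; split => //; lra.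
Qed.

Lemma usc_bounded_slab (u : 'rV[R]_n * R -> R) (t : R) :
  usc_on clO u -> exists m, 0 <= m /\
    forall x s, closure Omega x -> 0 <= s <= t -> u (x, s) <= m.
Proof.
move=> uscu.
have [K0|K0] := pselect ((closure Omega `*` [set s | 0 <= s <= t]) !=set0).
  have KA : closure Omega `*` [set s | 0 <= s <= t] `<=` clO.
    by move=> z [Oz /andP[z0 _]]; exact: closed_cylinderP.
  have [p _ pmin] := lsc_sub_argmin uscu (fun=> cvg_cst 0)
    (@compact_slab 0 t) KA K0.
  exists (Num.max 0 (u p)); split; first by rewrite le_max lexx.
  move=> x s Ox st; rewrite le_max; apply/orP; right.
  have := pmin (x, s); rewrite !subr0 lerN2; apply.
  by split.
exists 0; split => // x s Ox st; exfalso; apply: K0.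
by exists (x, s).
Qed.

(* The test function must dominate [u] on the whole cylinder, and nothing is
   known a priori on the growth of [u] in time: hence the series [g]. *)
Lemma subsolution_bounded (u : 'rV[R]_n * R -> R) (c T : R) :
  usc_on clO u -> (forall z, clO z -> 0 < u z) ->
  visc_sub H k (cylinder Omega) u ->
  0 < T -> (forall z, from_time (bdry Omega) T z -> u z <= c) ->
  exists M, forall x t, closure Omega x -> 0 <= t -> u (x, t) <= M.
Proof.
move=> uscu u0 sub T0 uc.
have [_ _ _ bO] := domO.
have [x0 [B HB0]] := exterior_center n_gt0 bO.
have [M0 [M00 HM0]] := usc_bounded_slab T uscu.
(* [N] bounds [u] up to time [T] and on the lateral boundary afterwards; [N + B - |x - x0|^2] is
   still at least [N]. *)
pose N := Num.max M0 c.
have NM : M0 <= N by rewrite le_max lexx.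
have Nc : c <= N by rewrite le_max lexx orbT.
exists (N + B) => x t Ox t_ge0; rewrite leNgt; apply/negP => ut.
have [tT|Tt] := leP t T.
  have : u (x, t) <= M0 by apply: HM0 => //; rewrite t_ge0.
  by have := HB0 _ Ox; lra.
pose n0 := (Num.truncn t).+1.
have tn0 : t < n0%:R by exact: truncnS_gt.
(* [g] is sure to reach [a i] only at [i + 1], so [S i] has to bound [u] until [i + 2], when the
   next term takes over. *)
have /choice[S HS] (i : nat) : exists m, 0 <= m /\
    forall x s, closure Omega x -> 0 <= s <= i%:R + 2 -> u (x, s) <= m.
  exact: usc_bounded_slab.
(* The initial zeros keep [g] zero at [t < n0], hence [psi (x, t) <= N + B < u (x, t)]. *)
pose a i := if (i < n0)%N then 0 else S i.
have a0 i : 0 <= a i by rewrite /a; case: ifP => // _; case: (HS i).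
have [g [g' [dg cg g_ge0 g0 ag]]] := C1_series a0.
pose psi := barrier x0 (N + B) (- 1) g.
have N_psi y s : closure Omega y -> N <= psi (y, s).
  move=> /HB0 /andP[_ yB]; rewrite /psi /barrier /=.
  by have [] := g_ge0 s; lra.
have [|||y s Oy s0 sout|||z [cz z1]] := @subsolution_touching u x0 (N + B)
    1 g g' T (n0%:R + 1) uscu sub dg cg T0 _ _ _ _ x t Ox.
- exact: ltr01.
- by move=> y /HB0/andP[].
- move=> y s Oy /andP[Ts _]; apply: (@le_trans _ _ N); last first.
    by apply: N_psi; case: Oy.
  by apply: le_trans Nc; apply: uc; split.
- have cy := subset_closure Oy.
  have [sT|Ts] := leP s T.
    apply: (le_trans _ (N_psi _ _ cy)); apply: le_trans NM.
    by apply: HM0 => //; rewrite ltW.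
  have ns : n0%:R + 1 < s by move: sout; rewrite (ltW Ts) /= -ltNge.
  have /andP[s1 s2] := truncn_itv (ltW s0).
  (* Here [s] lies in [[i + 1, i + 2)] with [i >= n0], so [g s >= S i >= u (y, s)]; truncation 0 is
     impossible as [s > 1]. *)
  case E : (Num.truncn s) s1 s2 => [|i] s1 s2.
    by have : 0 <= n0%:R :> R by []; lra.
  rewrite -!natr1 in s1 s2.
  have n0i : (n0 <= i)%N by rewrite -ltnS -(ltr_nat R) -natr1; lra.
  have := ag s i s1; rewrite /a ltnNge n0i /= => Sg.
  have [_ /(_ y s cy)] := HS i; rewrite (ltW s0) => /(_ _) uS.
  have /HB0/andP[_ yB] := cy.
  apply: (le_trans (uS _)); first by rewrite /=; lra.
  by rewrite /barrier /=; lra.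
- by rewrite (ltW Tt) /=; lra.
- rewrite /barrier /= (g0 n0) ?(ltW tn0) //.
    by have := HB0 _ Ox; lra.
  by move=> i; rewrite /a => ->.
have uz0 : 0 < u z by apply: u0; apply: closed_cylinderP => //; lra.
have [_ g'z] := g_ge0 z.2.
have m0 : 0 < mLow H 0 by apply: HC.1; exact: ltr01.
rewrite leNgt => /negP; apply; apply: (@lt_le_trans _ _ 0).
  by rewrite oppr_lt0 !mulr_gt0 // powR_gt0.
by rewrite mulr_ge0 // powR_ge0.
Qed.

(** Now that [u <= M] everywhere, [M] takes the role that [c] has for supersolutions in bounding
    [u^(k-1)] at the touching point. *)
Lemma subsolution_upper_bound (u : 'rV[R]_n * R -> R) (c T e : R) :
  usc_on clO u -> (forall z, clO z -> 0 < u z) ->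
  visc_sub H k (cylinder Omega) u ->
  0 < T -> (forall z, from_time (bdry Omega) T z -> u z <= c) -> 0 < e ->
  exists t0, forall z, from_time (closure Omega) t0 z -> u z <= c + e.
Proof.
move=> uscu u0 sub T0 uc e0.
have [M HM] := subsolution_bounded uscu u0 sub T0 uc.
have [_ _ _ bO] := domO.
have [x0 [B HB0]] := exterior_center n_gt0 bO.
have m0 : 0 < mLow H 0 by apply: HC.1; exact: ltr01.
pose b := e / (`|B| + 1).
have b0 : 0 < b by rewrite divr_gt0 // ltr_wpDl.
have bB : b * B <= e.
  rewrite /b mulrAC ler_pdivrMr ?ltr_wpDl // ler_pM2l //.
  by apply: (le_trans (ler_norm B)); rewrite lerDl.
pose eta := mLow H 0 * (2 * b) * (2 * b) `^ k1.
have bb0 : 0 < 2 * b by rewrite mulr_gt0.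
have eta0 : 0 < eta by rewrite !mulr_gt0 // powR_gt0.
(* The time parabola rises by [G] at the ends of the window, lifting the barrier there to at least
   [M]; the absolute value covers [M < c]. *)
pose G := `|M - c|.
have G0 : 0 <= G by exact: normr_ge0.
have GM : M <= c + G by rewrite -lerBlDl ler_norm.
clearbody G.
pose C := M `^ (k - 1) * (2 * G).
have C0 : 0 <= C by rewrite !mulr_ge0 ?powR_ge0.
have [t0 Tt0 dom] := quadratic_dominates C0 eta0 T0.
exists t0 => -[x s] [/= Ox st0]; rewrite leNgt; apply/negP => us.
have Ts : T < s by exact: lt_le_trans st0.
have s0 : 0 < s by exact: lt_trans Ts.
have d0 : 0 < (s - T) ^+ 2 by rewrite exprn_gt0 // subr_gt0.
pose eps := G / (s - T) ^+ 2.
have eps0 : 0 <= eps by rewrite divr_ge0 // ltW.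
have epsE : eps * (s - T) ^+ 2 = G by rewrite /eps mulfVK // gt_eqF.
clearbody eps.
pose g t := eps * (t - s) ^+ 2.
have dg := @is_derive_square eps s.
have cg := @continuous_affine eps s.
pose psi := barrier x0 (c + b * B) (- b) g.
have psi_ge y t : closure Omega y -> c + eps * (t - s) ^+ 2 <= psi (y, t).
  move=> /HB0 /andP[_ yB]; rewrite /psi /barrier /g /=.
  have : b * sqdist x0 y <= b * B by rewrite ler_pM2l.
  by lra.
have [y /HB0/andP[]|y t Oy /andP[Tt _]|y t Oy t_gt0 tout|||z [cz z1 Hz]] //:=
  @subsolution_touching u x0 (c + b * B) b g (fun t => 2 * eps * (t - s))
    T (2 * s - T) uscu sub dg cg T0 b0 _ _ _ x s Ox.
- apply: (@le_trans _ _ c); first by apply: uc; split.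
  apply: le_trans (psi_ge _ _ Oy.1); rewrite lerDl.
  by rewrite mulr_ge0 ?sqr_ge0.
- have cy := subset_closure Oy.
  apply: (le_trans (HM _ _ cy (ltW t_gt0))).
  apply: le_trans (psi_ge _ _ cy); apply: (le_trans GM); rewrite lerD2l.
  rewrite -{1}epsE ler_wpM2l //.
  move: tout; rewrite negb_and -!ltNge => /orP[] ?; nra.
- by apply/andP; split; lra.
- apply: le_lt_trans us; rewrite /barrier /g /= subrr expr0n mulr0 addr0.
  have /HB0/andP[y1 _] := Ox.
  have : 0 <= b * sqdist x0 x by rewrite mulr_ge0 ?(ltW b0) // (le_trans _ y1).
  by lra.
have z20 : 0 < z.2 by exact: lt_le_trans z1.
have uz0 : 0 < u z by apply: u0; apply: closed_cylinderP => //; exact: ltW.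
have uzM : u z `^ (k - 1) <= M `^ (k - 1).
  apply: powM => //; case: (z) cz z20 => y t /= cy t0'.
  by apply: HM => //; exact: ltW.
have := dom s st0; rewrite -/eta in Hz.
have -> : C * s = M `^ (k - 1) * (2 * eps * s) * (s - T) ^+ 2.
  by rewrite /C -epsE; ring.
rewrite ltr_pM2r // => dom'.
suff : - (u z `^ (k - 1) * (2 * eps * (z.2 - s))) <=
  M `^ (k - 1) * (2 * eps * s) by lra.
apply: (@le_trans _ _ (u z `^ (k - 1) * (2 * eps * s))).
  by rewrite -mulrN ler_wpM2l ?powR_ge0 //; nra.
by apply: ler_wpM2r => //; rewrite !mulr_ge0 // ltW.
Qed.

End comparison.

Theorem theorem1p3 (R : realType) (n : nat) (n_ge2 : (2 <= n)%N)
    (Omega : set 'rV[R]_n) (domO : bounded_domain Omega)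
    (H : 'rV[R]_n -> 'M[R]_n -> R) (k1 k : R)
    (HA : conditionA H) (HB : conditionB H k1) (HC : conditionC H)
    (kE : k = k1 + 1) (k_ge1 : 1 <= k)
    (h : 'rV[R]_n * R -> R)
    (h_cont : {within pbdry Omega, continuous h})
    (h_inf : (0 < inf_over (pbdry Omega) h)%E)
    (h_sup : (sup_over (pbdry Omega) h < +oo)%E)
    (T : R) (T_gt0 : 0 < T) :
  (forall (u : 'rV[R]_n * R -> R) (nu : \bar R),
     lsc_on (cylinder Omega `|` pbdry Omega) u ->
     (forall z, (cylinder Omega `|` pbdry Omega) z -> 0 < u z) ->
     visc_super H k (cylinder Omega) u ->
     (forall z, from_time (bdry Omega) T z -> u z = h z) ->
     inf_over (from_time (bdry Omega) t) h @[t --> +oo] --> nu ->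
     inf_over (from_time (closure Omega) t) u @[t --> +oo] --> nu)
  /\
  (forall (u : 'rV[R]_n * R -> R) (mu : \bar R),
     usc_on (cylinder Omega `|` pbdry Omega) u ->
     (forall z, (cylinder Omega `|` pbdry Omega) z -> 0 < u z) ->
     visc_sub H k (cylinder Omega) u ->
     (forall z, from_time (bdry Omega) T z -> u z = h z) ->
     sup_over (from_time (bdry Omega) t) h @[t --> +oo] --> mu ->
     sup_over (from_time (closure Omega) t) u @[t --> +oo] --> mu).
Proof.
have n_gt0 : (0 < n)%N by exact: leq_trans n_ge2.
have bd_cl : bdry Omega `<=` closure Omega by move=> x [].
split=> [u nu lscu u0 super uh|u mu uscu u0 sub uh].
- apply: (inf_over_cvg bd_cl uh) => c T1 TT1 uc e e0.
  exact: (supersolution_lower_bound n_gt0 domO HB HC k_ge1 lscu u0 super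
    (lt_le_trans T_gt0 TT1) uc e0).
(* Negation turns the suprema of [u] and [h] into infima of [- u] and [- h], so [inf_over_cvg]
   applies, with [- c] as the upper bound for [u]. *)
- have supN A f : (fun t => sup_over (from_time A t) f) =
      (fun t => - inf_over (from_time A t) (fun z => - f z)%R)%E
      :> (R -> \bar R).
    by apply/funext => t; exact: sup_overN.
  rewrite !supN => /cvgeN; under eq_fun do rewrite oppeK.
  move=> hmu; rewrite -[mu]oppeK; apply: cvgeN; move: hmu.
  apply: (inf_over_cvg bd_cl (T := T)) => [z /uh -> //|c T1 TT1 uc e e0].
  have [|t0 Ht0] := subsolution_upper_bound n_gt0 domO HB HC k_ge1 (c := - c)
    uscu u0 sub (lt_le_trans T_gt0 TT1) _ e0.
    by move=> z /uc; rewrite lerNr.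
  by exists t0 => z /Ht0; rewrite lerNr opprB addrC.
Qed.
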